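(* Let $c>0$, $g\in C^2(\mathbb{R})$, $h\in C^1(\mathbb{R})$, $\nu\in C^2(0,+\infty)$, and consider the Dirichlet problem $$u_{tt}-c^2u_{xx}=0\ (x>0,\ t>0),\quad u(x,0)=g(x),\ u_t(x,0)=h(x)\ (x>0),\quad u(0,t)=\nu(t)\ (t>0).$$ The solution $u$ of this problem (given by the explicit formula in the context) is discontinuous across the characteristic line $t=x/c$. The jump, given by $$[u]_{t=x/c}=\nu(0)-g(0),$$ is determined by the initial data $g(0)$ and the boundary data $\nu(0)$.
   Context: Domains: $D^+=\{(x,t): x>ct,\ t>0\}$ and $D^-=\{(x,t): 0<x<ct,\ t>0\}$, separated by the characteristic line $x-ct=0$. The solution of the Dirichlet problem is the function obtained from d'Alembert's formula: $$u(x,t)=\tfrac12[g(x+ct)+g(x-ct)]+\tfrac1{2c}\int_{x-ct}^{x+ct}h(\xi)\,d\xi,\quad (x,t)\in D^+,$$ $$u(x,t)=\tfrac12[g(x+ct)-g(-x+ct)]+\tfrac1{2c}\Big[\int_0^{x+ct}h(\xi)\,d\xi-\int_0^{ct-x}h(\xi)\,d\xi\Big]+\nu(t-x/c),\quad (x,t)\in D^-.$$ The jump across the line is $[u]_{t=x/c}:=u(x,x/c)_{(x,t)\in D^-}-u(x,x/c)_{(x,t)\in D^+}$, where the subscripts indicate that the value on the line $t=x/c$ is taken from the $D^-$ side (second formula) and from the $D^+$ side (first formula), respectively. $\nu(0)$ is the value of the boundary data at $t=0$.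
   Formalization: Discontinuity is asserted exactly when ν(0) ≠ g(0) (if they are equal the jump is zero), and for that part ν(0) is required to be the right-hand limit of ν at 0; the jump formula itself needs neither condition. *)

(* Defs.v *)
From Stdlib Require Import Reals.
From Coquelicot Require Import Coquelicot.
Open Scope R_scope.

(* [D] is meant to be open. Derivatives of every order [j <= k] are required
   because [ex_derive_n f k x] alone says nothing about the lower orders. *)
Definition Ck_on (k : nat) (D : R -> Prop) (f : R -> R) : Prop :=
  forall x, D x ->
    (forall j, (j <= k)%nat -> ex_derive_n f j x) /\
    continuous (Derive_n f k) x.

Definition quadrant (p : R * R) : Prop := 0 < fst p /\ 0 < snd p.

Definition D_plus (c : R) (p : R * R) : Prop :=
  c * snd p < fst p /\ 0 < snd p.

Definition D_minus (c : R) (p : R * R) : Prop :=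
  0 < fst p < c * snd p /\ 0 < snd p.

Definition lim_in (D : R * R -> Prop) (f : R -> R -> R) (p : R * R) (l : R)
  : Prop :=
  filterlim (fun q => f (fst q) (snd q)) (within D (locally p)) (locally l).

Definition u_plus (c : R) (g h : R -> R) (x t : R) : R :=
  / 2 * (g (x + c * t) + g (x - c * t))
  + / (2 * c) * RInt h (x - c * t) (x + c * t).

Definition u_minus (c : R) (g h nu : R -> R) (x t : R) : R :=
  / 2 * (g (x + c * t) - g (- x + c * t))
  + / (2 * c) * (RInt h 0 (x + c * t) - RInt h 0 (c * t - x))
  + nu (t - x / c).

(* The values of [u] on the line [x = c * t], as well as outside the open
   quadrant, are left unspecified. *)
Definition given_by_dAlembert (c : R) (g h nu : R -> R) (u : R -> R -> R)
  : Prop :=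
  (forall x t, D_plus c (x, t) -> u x t = u_plus c g h x t) /\
  (forall x t, D_minus c (x, t) -> u x t = u_minus c g h nu x t).

(* The equation is imposed classically off the characteristic line, across
   which [u] may jump. As [u] is only specified inside the quadrant, the
   initial and boundary values are traces, i.e. limits from inside. *)
Definition solves_dirichlet (c : R) (g h nu : R -> R) (u : R -> R -> R)
  : Prop :=
  (forall x t, D_plus c (x, t) \/ D_minus c (x, t) ->
     (forall j, (j <= 2)%nat ->
        ex_derive_n (fun s => u x s) j t /\ ex_derive_n (fun y => u y t) j x) /\
     Derive_n (fun s => u x s) 2 t - c ^ 2 * Derive_n (fun y => u y t) 2 x = 0)
  /\
  (forall x, 0 < x -> lim_in quadrant u (x, 0) (g x)) /\
  (forall x, 0 < x ->
     lim_in quadrant (fun y t => Derive (fun s => u y s) t) (x, 0) (h x)) /\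
  (forall t, 0 < t -> lim_in quadrant u (0, t) (nu t)).

Definition jump (c : R) (g h nu : R -> R) (x : R) : R :=
  u_minus c g h nu x (x / c) - u_plus c g h x (x / c).

(* [u] has no continuous extension from the two open sectors to the point
   [(x, x / c)] of the line. *)
Definition discontinuous_across (c : R) (u : R -> R -> R) (x : R) : Prop :=
  ~ exists l : R,
      lim_in (fun p => D_plus c p \/ D_minus c p) u (x, x / c) l.

(* Main.v *)
Require Import Defs.
From Stdlib Require Import Reals Lra Lia.
From Coquelicot Require Import Coquelicot.
Open Scope R_scope.

(** Both branches of d'Alembert's formula have the form
    [F (x + c * t) + K (c * t - x)], with the same incoming profile
    [F y = g y / 2 + (RInt h 0 y) / (2 * c)] in both sectors.  Only the outgoing
    profile changes: ahead of the line [x = c * t] it is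
    [g (- y) / 2 - (RInt h 0 (- y)) / (2 * c)], dictated by the initial data,
    and behind it is [nu (y / c) - F y], the reflection of [F] corrected by the
    boundary data so that the sum of the two waves is [nu] at [x = 0].

    Any such superposition of twice differentiable profiles solves the wave
    equation ([wave_equation]), because two time derivatives produce the factor
    [c ^ 2] and two space derivatives the factor [1] or [(-1) ^ 2].  The traces
    follow by continuity: near a point of either axis the quadrant meets a
    single sector, so [u] coincides there with one superposition.  For the
    initial velocity one needs in addition that the first derivatives of the
    profiles are continuous, and that [c * (F' x + K' (- x)) = h x]
    ([initial_velocity]).

    At the characteristic line the incoming part is continuous and the phase
    [c * t - x] tends to [0], from the right within [D_minus].  The jump is
    therefore the difference at [0] of the two outgoing profiles,
    [(nu 0 - g 0 / 2) - g 0 / 2].  When [nu] is right-continuous at [0], the two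
    branches evaluated on the line are the limits of [u] from the two sectors;
    a common limit exists exactly when these agree
    ([discontinuous_across_iff]), that is, when the jump vanishes. *)

(** * Differentiability near a point *)

(** The lower orders and the whole neighbourhood are included because the rules
    for iterated derivatives of sums and of dilations require them; in this form
    the property is stable under the operations that build the profiles. *)
Definition Dn_near (n : nat) (f : R -> R) (y : R) : Prop :=
  locally y (fun z => forall j, (j <= n)%nat -> ex_derive_n f j z).

Lemma Dn_near_at n f y j : Dn_near n f y -> (j <= n)%nat -> ex_derive_n f j y.
Proof. intros H Hj. exact (locally_singleton _ _ H j Hj). Qed.

Lemma Dn_near_le m n f y : (m <= n)%nat -> Dn_near n f y -> Dn_near m f y.
Proof.
  intros Hmn. unfold Dn_near. apply filter_imp. intros z Hz j Hj. apply Hz. lia.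
Qed.

Lemma Dn_near_plus n f g y :
  Dn_near n f y -> Dn_near n g y -> Dn_near n (fun z => f z + g z) y.
Proof.
  intros Hf Hg.
  generalize (filter_and _ _ (locally_locally _ _ Hf) (locally_locally _ _ Hg)).
  unfold Dn_near. apply filter_imp. intros z [Hfz Hgz] j Hj.
  apply ex_derive_n_plus;
    [exact (Dn_near_le _ _ _ _ Hj Hfz) | exact (Dn_near_le _ _ _ _ Hj Hgz)].
Qed.

Lemma Dn_near_scal n a f y : Dn_near n f y -> Dn_near n (fun z => a * f z) y.
Proof.
  unfold Dn_near. apply filter_imp. intros z Hz j Hj. apply ex_derive_n_scal_l. now apply Hz.
Qed.

Lemma Dn_near_translate n f b y :
  Dn_near n f (y + b) -> Dn_near n (fun z => f (z + b)) y.
Proof.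
  intros Hf.
  assert (Hc : continuous (fun z => z + b) y).
  { apply (continuous_plus (fun z : R => z) (fun _ => b));
      [apply continuous_id | apply continuous_const]. }
  generalize (Hc _ Hf). unfold filtermap, Dn_near. apply filter_imp. intros z Hz j Hj.
  apply ex_derive_n_comp_trans. now apply Hz.
Qed.

Lemma continuous_scal_R a y : continuous (fun z : R => a * z) y.
Proof.
  apply (continuous_scal_r a (fun z : R => z)). apply continuous_id.
Qed.

Lemma Dn_near_dilate n f a y :
  Dn_near n f (a * y) -> Dn_near n (fun z => f (a * z)) y.
Proof.
  intros Hf.
  generalize (continuous_scal_R a y _ (locally_locally _ _ Hf)).
  unfold filtermap, Dn_near. apply filter_imp. intros z Hz j Hj. apply ex_derive_n_comp_scal.
  exact (Dn_near_le _ _ _ _ Hj Hz).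
Qed.

Lemma Dn_near_affine n f a b y :
  Dn_near n f (a * y + b) -> Dn_near n (fun z => f (a * z + b)) y.
Proof.
  intros Hf. apply (Dn_near_dilate n (fun z => f (z + b))).
  now apply Dn_near_translate.
Qed.

Lemma Derive_n_affine n f a b y :
  Dn_near n f (a * y + b) ->
  Derive_n (fun z => f (a * z + b)) n y = a ^ n * Derive_n f n (a * y + b).
Proof.
  intros Hf. rewrite (Derive_n_comp_scal (fun z => f (z + b))).
  - now rewrite Derive_n_comp_trans.
  - now apply Dn_near_translate.
Qed.

Lemma Dn_near_continuous n f y : Dn_near (S n) f y -> continuous f y.
Proof.
  intros Hf. apply (@ex_derive_continuous R_AbsRing R_NormedModule f y).
  apply (Dn_near_at _ _ _ 1 Hf). lia.
Qed.

Lemma Dn_near_ext_loc n f g y :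
  locally y (fun z => f z = g z) -> Dn_near n f y -> Dn_near n g y.
Proof.
  intros He Hf. generalize (filter_and _ _ (locally_locally _ _ He) Hf).
  unfold Dn_near. apply filter_imp. intros z [Hez Hfz] j Hj.
  apply (ex_derive_n_ext_loc f); auto.
Qed.

Lemma Dn_near_open k (D : R -> Prop) f y :
  locally y D -> Ck_on k D f -> Dn_near k f y.
Proof.
  intros HD Hf. revert HD. unfold Dn_near. apply filter_imp.
  intros z Hz. apply Hf, Hz.
Qed.

Lemma Dn_near_everywhere k f y : Ck_on k (fun _ => True) f -> Dn_near k f y.
Proof. apply Dn_near_open. now apply filter_forall. Qed.

Lemma is_derive_primitive (h : R -> R) y :
  (forall z, continuous h z) -> is_derive (fun z => RInt h 0 z) y (h y).
Proof.
  intros Hh. apply (is_derive_RInt h _ 0); [|apply Hh].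
  apply filter_forall. intros z. apply (@RInt_correct R_CompleteNormedModule).
  apply (@ex_RInt_continuous R_CompleteNormedModule). intros; apply Hh.
Qed.

(** Continuity of [h] is global because the integral runs from [0] to a possibly
    distant [y], across which [h] has to be integrable. *)
Lemma Dn_near_primitive n h y :
  (forall z, continuous h z) -> Dn_near n h y ->
  Dn_near (S n) (fun z => RInt h 0 z) y.
Proof.
  intros Hh. unfold Dn_near. apply filter_imp. intros z Hz [|j] Hj; [exact I|].
  destruct j as [|j].
  - exists (h z). now apply is_derive_primitive.
  - assert (He : forall w, Derive_n (fun z => RInt h 0 z) (S j) w = Derive_n h j w).
    { clear -Hh. induction j; intros w; simpl.
      - apply is_derive_unique. now apply is_derive_primitive.
      - now apply Derive_ext. }
    apply (ex_derive_ext (Derive_n h j)); [now intros; rewrite He|]. apply (Hz (S j)). lia.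
Qed.

(** * Limits along open sectors *)

Lemma continuous_linear a b (p : R * R) :
  continuous (fun q : R * R => a * fst q + b * snd q) p.
Proof.
  apply (continuous_plus (fun q : R * R => a * fst q) (fun q => b * snd q)).
  - apply (continuous_scal_r a (fun q : R * R => fst q)). destruct p; apply continuous_fst.
  - apply (continuous_scal_r b (fun q : R * R => snd q)). destruct p; apply continuous_snd.
Qed.

Lemma locally_half_plane a b (p : R * R) :
  0 < a * fst p + b * snd p -> locally p (fun q => 0 < a * fst q + b * snd q).
Proof.
  intros Hp. apply (continuous_linear a b p (fun y => 0 < y)).
  apply open_gt. exact Hp.
Qed.

Lemma locally_slice_l (P : R * R -> Prop) x t :
  locally (x, t) P -> locally t (fun s => P (x, s)).
Proof.
  intros [e He]. exists e. intros s Hs. apply He. split; [apply ball_center | exact Hs].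
Qed.

Lemma locally_slice_r (P : R * R -> Prop) x t :
  locally (x, t) P -> locally x (fun y => P (y, t)).
Proof.
  intros [e He]. exists e. intros s Hs. apply He. split; [exact Hs | apply ball_center].
Qed.

Lemma locally_D_plus c p : D_plus c p -> locally p (D_plus c).
Proof.
  intros [H1 H2].
  assert (H1' : 0 < 1 * fst p + - c * snd p) by lra.
  assert (H2' : 0 < 0 * fst p + 1 * snd p) by lra.
  generalize (filter_and _ _ (locally_half_plane _ _ _ H1') (locally_half_plane _ _ _ H2')).
  apply filter_imp. intros [y s] [Q1 Q2]. simpl in *. split; simpl; lra.
Qed.

Lemma locally_D_minus c p : D_minus c p -> locally p (D_minus c).
Proof.
  intros [[H0 H1] H2].
  assert (H0' : 0 < 1 * fst p + 0 * snd p) by lra.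
  assert (H1' : 0 < -1 * fst p + c * snd p) by lra.
  assert (H2' : 0 < 0 * fst p + 1 * snd p) by lra.
  generalize (filter_and _ _ (locally_half_plane _ _ _ H0')
    (filter_and _ _ (locally_half_plane _ _ _ H1') (locally_half_plane _ _ _ H2'))).
  apply filter_imp. intros [y s] (Q0 & Q1 & Q2). simpl in *. repeat split; simpl; lra.
Qed.

(** Only one branch of the formula is visible near a point of an axis other than
    the origin, which is why the traces do not see the jump. *)
Lemma quadrant_near_initial_line c x :
  0 < x -> locally (x, 0) (fun q => quadrant q -> D_plus c q).
Proof.
  intros Hx.
  assert (H : 0 < 1 * fst (x, 0) + - c * snd (x, 0)) by (simpl; lra).
  generalize (locally_half_plane _ _ _ H).
  apply filter_imp. intros [y s] Q [_ Qt]. simpl in *. split; simpl; lra.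
Qed.

Lemma quadrant_near_boundary_line c t :
  0 < c * t -> locally (0, t) (fun q => quadrant q -> D_minus c q).
Proof.
  intros Ht.
  assert (H : 0 < -1 * fst (0, t) + c * snd (0, t)) by (simpl; lra).
  generalize (locally_half_plane _ _ _ H).
  apply filter_imp. intros [y s] Q [Qx Qt]. simpl in *. repeat split; simpl; lra.
Qed.

Lemma lim_in_ext (D : R * R -> Prop) f g p l :
  locally p (fun q => D q -> f (fst q) (snd q) = g (fst q) (snd q)) ->
  lim_in D f p l -> lim_in D g p l.
Proof.
  intros He. apply filterlim_ext_loc. unfold within. exact He.
Qed.

Lemma lim_in_subset (D E : R * R -> Prop) f p l :
  (forall q, D q -> E q) -> lim_in E f p l -> lim_in D f p l.
Proof.
  intros HDE HE P HP.
  assert (HEP : locally p (fun q => E q -> P (f (fst q) (snd q)))) by exact (HE P HP).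
  revert HEP. unfold filtermap, within. apply filter_imp. auto.
Qed.

Lemma lim_in_union (D E : R * R -> Prop) f p l :
  lim_in D f p l -> lim_in E f p l -> lim_in (fun q => D q \/ E q) f p l.
Proof.
  intros HD HE P HP.
  assert (HDP : locally p (fun q => D q -> P (f (fst q) (snd q)))) by exact (HD P HP).
  assert (HEP : locally p (fun q => E q -> P (f (fst q) (snd q)))) by exact (HE P HP).
  generalize (filter_and _ _ HDP HEP).
  unfold filtermap, within. apply filter_imp. intros q [H1 H2] [H|H]; auto.
Qed.

(** Adherence of [p] to [D] makes [within D (locally p)] a proper filter; without
    it every [l] would be a limit. *)
Lemma lim_in_unique (D : R * R -> Prop) f p l1 l2 :
  (forall P, locally p P -> exists q, D q /\ P q) ->
  lim_in D f p l1 -> lim_in D f p l2 -> l1 = l2.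
Proof.
  intros Hadh H1 H2.
  assert (HF : ProperFilter (within D (locally p))).
  { split; [|apply within_filter, locally_filter].
    intros P HP. destruct (Hadh _ HP) as (q & Dq & Hq). exists q. exact (Hq Dq). }
  apply (@filterlim_locally_unique _ R_AbsRing R_NormedModule (within D (locally p)) _
    (fun q => f (fst q) (snd q))); assumption.
Qed.

Lemma D_plus_adherent c x t (P : R * R -> Prop) :
  x = c * t -> 0 < t -> locally (x, t) P -> exists q, D_plus c q /\ P q.
Proof.
  intros Hx Ht HP. destruct (locally_slice_r _ _ _ HP) as [e He].
  pose proof (cond_pos e).
  exists (x + e / 2, t). split; [split; simpl; lra|].
  apply He. change (Rabs (x + e / 2 - x) < e). rewrite Rabs_pos_eq; lra.
Qed.

Lemma D_minus_adherent c x t (P : R * R -> Prop) :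
  x = c * t -> 0 < x -> 0 < t -> locally (x, t) P -> exists q, D_minus c q /\ P q.
Proof.
  intros Hx Hx0 Ht HP. destruct (locally_slice_r _ _ _ HP) as [e He].
  pose proof (cond_pos e). set (d := Rmin (e / 2) (x / 2)).
  assert (0 < d) by (apply Rmin_glb_lt; lra).
  assert (d <= e / 2) by apply Rmin_l. assert (d <= x / 2) by apply Rmin_r.
  exists (x - d, t). split; [repeat split; simpl; lra|].
  apply He. change (Rabs (x - d - x) < e). rewrite Rabs_left; lra.
Qed.

(** The characteristic line lies in the closure of both sectors: a limit from
    their union must equal both one-sided limits, and equal one-sided limits
    combine into one. *)
Lemma discontinuous_across_iff c u x a b :
  0 < c -> 0 < x ->
  lim_in (D_minus c) u (x, x / c) a -> lim_in (D_plus c) u (x, x / c) b ->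
  (discontinuous_across c u x <-> a <> b).
Proof.
  intros Hc Hx Ha Hb.
  assert (Hline : x = c * (x / c)) by (field; lra).
  assert (Ht : 0 < x / c) by (now apply Rdiv_lt_0_compat).
  split.
  - intros Hd Hab. subst b. apply Hd. exists a. now apply lim_in_union.
  - intros Hab [l Hl]. apply Hab. transitivity l.
    + apply (lim_in_unique (D_minus c) u (x, x / c)); [|exact Ha|].
      * intros P. now apply D_minus_adherent.
      * revert Hl. apply lim_in_subset. auto.
    + apply (lim_in_unique (D_plus c) u (x, x / c)); [| |exact Hb].
      * intros P. now apply D_plus_adherent.
      * revert Hl. apply lim_in_subset. auto.
Qed.

(** * Superpositions of two travelling waves *)

(** The second phase is [c * t - x] rather than [x - c * t] so that it is positive
    behind the characteristic line, where the profile is read from boundary data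
    given for positive times. *)
Definition wave (c : R) (F K : R -> R) (x t : R) : R := F (x + c * t) + K (c * t - x).

(** Along each axis the two phases are affine, with slopes [c] and [c] in time,
    [1] and [-1] in space.  The function [u] is only assumed to agree with the
    wave near the point, as happens inside one of the sectors. *)
Lemma wave_derivatives c F K u x t :
  Dn_near 2 F (x + c * t) -> Dn_near 2 K (c * t - x) ->
  locally (x, t) (fun q => u (fst q) (snd q) = wave c F K (fst q) (snd q)) ->
  forall j, (j <= 2)%nat ->
    (ex_derive_n (fun s => u x s) j t /\
     Derive_n (fun s => u x s) j t =
       c ^ j * (Derive_n F j (x + c * t) + Derive_n K j (c * t - x))) /\
    (ex_derive_n (fun y => u y t) j x /\
     Derive_n (fun y => u y t) j x =
       Derive_n F j (x + c * t) + (-1) ^ j * Derive_n K j (c * t - x)).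
Proof.
  intros HF HK Hu j Hj.
  assert (Et : locally t (fun s => F (c * s + x) + K (c * s + - x) = u x s)).
  { generalize (locally_slice_l _ _ _ Hu). apply filter_imp. intros s Hs.
    simpl in Hs. rewrite Hs. unfold wave. f_equal; f_equal; ring. }
  assert (Ex : locally x (fun y => F (1 * y + c * t) + K (-1 * y + c * t) = u y t)).
  { generalize (locally_slice_r _ _ _ Hu). apply filter_imp. intros y Hy.
    simpl in Hy. rewrite Hy. unfold wave. f_equal; f_equal; ring. }
  assert (E1 : x + c * t = c * t + x) by ring.
  assert (E2 : c * t - x = c * t + - x) by ring.
  assert (E3 : x + c * t = 1 * x + c * t) by ring.
  assert (E4 : c * t - x = -1 * x + c * t) by ring.
  split.
  - rewrite E1, E2 in *.
    assert (Ft := Dn_near_affine _ _ _ _ _ HF). assert (Kt := Dn_near_affine _ _ _ _ _ HK).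
    split.
    + apply (ex_derive_n_ext_loc _ _ _ _ Et).
      exact (Dn_near_at _ _ _ _ (Dn_near_plus _ _ _ _ Ft Kt) Hj).
    + rewrite <- (Derive_n_ext_loc _ _ _ _ Et).
      rewrite Derive_n_plus by (eapply Dn_near_le; eassumption).
      rewrite !Derive_n_affine by (eapply Dn_near_le; eassumption). ring.
  - rewrite E3 in *. rewrite E4 in *.
    assert (Fx := Dn_near_affine _ _ _ _ _ HF). assert (Kx := Dn_near_affine _ _ _ _ _ HK).
    split.
    + apply (ex_derive_n_ext_loc _ _ _ _ Ex).
      exact (Dn_near_at _ _ _ _ (Dn_near_plus _ _ _ _ Fx Kx) Hj).
    + rewrite <- (Derive_n_ext_loc _ _ _ _ Ex).
      rewrite Derive_n_plus by (eapply Dn_near_le; eassumption).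
      rewrite !Derive_n_affine by (eapply Dn_near_le; eassumption). rewrite pow1. ring.
Qed.

Lemma wave_equation c F K u x t :
  Dn_near 2 F (x + c * t) -> Dn_near 2 K (c * t - x) ->
  locally (x, t) (fun q => u (fst q) (snd q) = wave c F K (fst q) (snd q)) ->
  (forall j, (j <= 2)%nat ->
     ex_derive_n (fun s => u x s) j t /\ ex_derive_n (fun y => u y t) j x) /\
  Derive_n (fun s => u x s) 2 t - c ^ 2 * Derive_n (fun y => u y t) 2 x = 0.
Proof.
  intros HF HK Hu. pose proof (wave_derivatives c F K u x t HF HK Hu) as H.
  split.
  - intros j Hj. destruct (H j Hj) as [[Ht _] [Hx _]]. now split.
  - destruct (H 2%nat (le_n 2)) as [[_ ->] [_ ->]]. ring.
Qed.

Lemma lim_in_wave (D : R * R -> Prop) c (F K : R -> R) x t lF lK :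
  filterlim (fun q => F (fst q + c * snd q)) (within D (locally (x, t))) (locally lF) ->
  filterlim (fun q => K (c * snd q - fst q)) (within D (locally (x, t))) (locally lK) ->
  lim_in D (wave c F K) (x, t) (lF + lK).
Proof.
  intros HF HK.
  refine (filterlim_comp_2 _ _ Rplus HF HK _).
  apply (filterlim_plus (V := R_NormedModule) lF lK).
Qed.

Lemma lim_forward_phase (D : R * R -> Prop) c (F : R -> R) x t :
  continuous F (x + c * t) ->
  filterlim (fun q => F (fst q + c * snd q)) (within D (locally (x, t)))
    (locally (F (x + c * t))).
Proof.
  intros HF. apply (filterlim_filter_le_1 _ (filter_le_within (F := locally (x, t)) D)).
  apply (filterlim_comp _ _ _ (fun q : R * R => fst q + c * snd q) F _ (locally (x + c * t)));
      [|exact HF].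
  generalize (continuous_linear 1 c (x, t)). unfold continuous. simpl.
    rewrite Rmult_1_l. apply filterlim_ext. intros q. now rewrite Rmult_1_l.
Qed.

Lemma lim_backward_phase (D : R * R -> Prop) c (K : R -> R) x t :
  continuous K (c * t - x) ->
  filterlim (fun q => K (c * snd q - fst q)) (within D (locally (x, t)))
    (locally (K (c * t - x))).
Proof.
  intros HK. apply (filterlim_filter_le_1 _ (filter_le_within (F := locally (x, t)) D)).
  apply (filterlim_comp _ _ _ (fun q : R * R => c * snd q - fst q) K _ (locally (c * t - x)));
      [|exact HK].
    generalize (continuous_linear (-1) c (x, t)). unfold continuous. simpl.
    replace (-1 * x + c * t) with (c * t - x) by ring.
    apply filterlim_ext. intros q. ring.
Qed.

Lemma lim_in_wave_continuous (D : R * R -> Prop) c (F K : R -> R) x t :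
  continuous F (x + c * t) -> continuous K (c * t - x) ->
  lim_in D (wave c F K) (x, t) (wave c F K x t).
Proof.
  intros HF HK. apply lim_in_wave.
  - now apply lim_forward_phase.
  - now apply lim_backward_phase.
Qed.

(** * The two branches of d'Alembert's formula as waves *)

Definition incoming (c : R) (g h : R -> R) (y : R) : R :=
  / 2 * g y + / (2 * c) * RInt h 0 y.

(** Evaluated at [c * t - x], this is the part of d'Alembert's formula that
    depends on [x - c * t]. *)
Definition outgoing_initial (c : R) (g h : R -> R) (y : R) : R :=
  / 2 * g (- y) - / (2 * c) * RInt h 0 (- y).

(** Chosen so that the sum with [incoming] at the same phase, the value on the
    axis [x = 0], is the boundary data. *)
Definition outgoing_reflected (c : R) (g h nu : R -> R) (y : R) : R :=
  nu (y / c) - incoming c g h y.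

Lemma u_plus_wave c g h x t :
  (forall y, continuous (h : R -> R) y) ->
  u_plus c g h x t = wave c (incoming c g h) (outgoing_initial c g h) x t.
Proof.
  intros Hh.
  assert (Hex : forall a b, ex_RInt h a b).
  { intros a b. apply (@ex_RInt_continuous R_CompleteNormedModule). intros; apply Hh. }
  unfold u_plus, wave, incoming, outgoing_initial.
  replace (- (c * t - x)) with (x - c * t) by ring.
  rewrite <- (RInt_Chasles h (x - c * t) 0 (x + c * t)) by apply Hex.
  rewrite <- (opp_RInt_swap h 0 (x - c * t)) by apply Hex.
  unfold plus, opp; simpl. ring.
Qed.

Lemma u_minus_wave c g h nu x t :
  0 < c ->
  u_minus c g h nu x t = wave c (incoming c g h) (outgoing_reflected c g h nu) x t.
Proof.
  intros Hc. unfold u_minus, wave, outgoing_reflected, incoming.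
  replace (- x + c * t) with (c * t - x) by ring.
  replace ((c * t - x) / c) with (t - x / c) by (field; lra). ring.
Qed.

Lemma incoming_regular c g h y :
  Ck_on 2 (fun _ => True) g -> Ck_on 1 (fun _ => True) h ->
  Dn_near 2 (incoming c g h) y.
Proof.
  intros Hg Hh. apply Dn_near_plus; apply Dn_near_scal.
  - now apply Dn_near_everywhere.
  - apply Dn_near_primitive; [|now apply Dn_near_everywhere].
    intros z. apply (Dn_near_continuous 0). now apply Dn_near_everywhere.
Qed.

Lemma outgoing_initial_regular c g h y :
  Ck_on 2 (fun _ => True) g -> Ck_on 1 (fun _ => True) h ->
  Dn_near 2 (outgoing_initial c g h) y.
Proof.
  intros Hg Hh.
  (* Reversing the velocity turns one profile into the other one. *)
  apply (Dn_near_ext_loc _ (fun z => incoming (- c) g h (-1 * z))).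
  - apply filter_forall. intros z. unfold incoming, outgoing_initial.
    replace (-1 * z) with (- z) by ring.
    replace (2 * - c) with (- (2 * c)) by ring. rewrite Rinv_opp. ring.
  - apply Dn_near_dilate. now apply incoming_regular.
Qed.

Lemma outgoing_reflected_regular c g h nu y :
  0 < c -> 0 < y ->
  Ck_on 2 (fun _ => True) g -> Ck_on 1 (fun _ => True) h ->
  Ck_on 2 (fun t => 0 < t) nu ->
  Dn_near 2 (outgoing_reflected c g h nu) y.
Proof.
  intros Hc Hy Hg Hh Hnu.
  apply (Dn_near_ext_loc _ (fun z => nu (/ c * z) + -1 * incoming c g h z)).
  - apply filter_forall. intros z. unfold outgoing_reflected, Rdiv.
    rewrite (Rmult_comm z). ring.
  - apply Dn_near_plus.
    + apply Dn_near_dilate. revert Hnu. apply Dn_near_open.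
      apply open_gt. apply Rmult_lt_0_compat; [now apply Rinv_0_lt_compat | exact Hy].
    + apply Dn_near_scal. now apply incoming_regular.
Qed.

(** The contributions of [g] cancel and those of [h] add up: the left-hand side
    is the time derivative at [t = 0] of the wave ahead of the characteristic
    line. *)
Lemma initial_velocity c g h x :
  c <> 0 -> ex_derive g x -> (forall y, continuous (h : R -> R) y) ->
  c * (Derive (incoming c g h) x + Derive (outgoing_initial c g h) (- x)) = h x.
Proof.
  intros Hc Hg Hh.
  assert (DH := is_derive_primitive h x Hh).
  assert (DF : is_derive (incoming c g h) x (/ 2 * Derive g x + / (2 * c) * h x)).
  { apply (is_derive_plus (fun y => / 2 * g y) (fun y => / (2 * c) * RInt h 0 y)).
    - apply is_derive_scal. now apply Derive_correct.
    - now apply is_derive_scal. }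
  assert (DK : is_derive (outgoing_initial c g h) (- x)
                 (-1 * (/ 2 * Derive g x - / (2 * c) * h x))).
  { apply (is_derive_comp (fun y => / 2 * g y - / (2 * c) * RInt h 0 y) Ropp).
    - rewrite Ropp_involutive.
      apply (is_derive_minus (fun y => / 2 * g y) (fun y => / (2 * c) * RInt h 0 y)).
      + apply is_derive_scal. now apply Derive_correct.
      + now apply is_derive_scal.
    - apply (is_derive_opp (fun y : R => y)). apply (@is_derive_id R_AbsRing). }
  rewrite (is_derive_unique _ _ _ DF), (is_derive_unique _ _ _ DK). now field.
Qed.

(** * The jump and the solution *)

Lemma jump_value c g h nu x : 0 < c -> jump c g h nu x = nu 0 - g 0.
Proof.
  intros Hc. unfold jump, u_minus, u_plus.
  replace (c * (x / c)) with x by (field; lra).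
  replace (- x + x) with 0 by ring.
  replace (x - x) with 0 by ring.
  replace (x / c - x / c) with 0 by ring.
  rewrite RInt_point. unfold zero; simpl. field. lra.
Qed.

(** Inside [D_minus] the phase [c * t - x] stays positive, so at the
    characteristic line a right-hand limit of the profile is enough. *)
Lemma lim_reflected_phase c (K : R -> R) x t l :
  c * t = x ->
  filterlim K (at_right 0) (locally l) ->
  filterlim (fun q => K (c * snd q - fst q)) (within (D_minus c) (locally (x, t)))
    (locally l).
Proof.
  intros Hx HK. eapply filterlim_comp; [|exact HK].
  intros P HP.
  assert (H0 : locally (c * t - x) (fun y => 0 < y -> P y)).
  { replace (c * t - x) with 0 by lra. exact HP. }
  assert (Hlin := lim_backward_phase (fun _ => True) c (fun y => y) x t (continuous_id _) _ H0).
  revert Hlin. unfold filtermap, within. apply filter_imp.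
  intros [y s] Hq [[_ Hd] _]. simpl in *. apply Hq; auto. lra.
Qed.

(** Right-continuity of [nu] at [0] passes to the profile, since division by
    [c > 0] preserves the right-hand neighbourhoods of [0]. *)
Lemma outgoing_reflected_at_right c g h nu :
  0 < c -> continuous (incoming c g h) 0 ->
  filterlim nu (at_right 0) (locally (nu 0)) ->
  filterlim (outgoing_reflected c g h nu) (at_right 0)
    (locally (outgoing_reflected c g h nu 0)).
Proof.
  intros Hc HF Hnu. unfold outgoing_reflected.
  replace (0 / c) with 0 by (field; lra).
  assert (Hscaled : filterlim (fun y => nu (y / c)) (at_right 0) (locally (nu 0))).
  { apply (filterlim_comp _ _ _ (fun y => y / c) nu _ (at_right 0)); [|exact Hnu].
    intros P HP.
    assert (H0 : locally (/ c * 0) (fun y => 0 < y -> P y))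
      by (rewrite Rmult_0_r; exact HP).
    generalize (continuous_scal_R (/ c) 0 _ H0).
    unfold filtermap, at_right, within. apply filter_imp. intros y Hy Hy0.
    unfold Rdiv. rewrite Rmult_comm. apply Hy.
    apply Rmult_lt_0_compat; [now apply Rinv_0_lt_compat | exact Hy0]. }
  refine (filterlim_comp_2 _ (fun y => opp (incoming c g h y)) Rplus Hscaled
    (H := locally (opp (incoming c g h 0))) _ _).
  - apply (filterlim_filter_le_1 _ (filter_le_within (F := locally 0) (fun y => 0 < y))).
    apply (continuous_opp (V := R_NormedModule) (incoming c g h)). exact HF.
  - apply (filterlim_plus (V := R_NormedModule) (nu 0) (opp (incoming c g h 0))).
Qed.

Theorem proposition1 (c : R) (g h nu : R -> R) (u : R -> R -> R)
  (hc : 0 < c)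
  (hg : Ck_on 2 (fun _ => True) g)
  (hh : Ck_on 1 (fun _ => True) h)
  (hnu : Ck_on 2 (fun t => 0 < t) nu)
  (hu : given_by_dAlembert c g h nu u) :
  solves_dirichlet c g h nu u /\
  (forall x, 0 < x -> jump c g h nu x = nu 0 - g 0) /\
  (filterlim nu (at_right 0) (locally (nu 0)) ->
   forall x, 0 < x ->
     lim_in (D_minus c) u (x, x / c) (u_minus c g h nu x (x / c)) /\
     lim_in (D_plus c) u (x, x / c) (u_plus c g h x (x / c)) /\
     (discontinuous_across c u x <-> nu 0 <> g 0)).
Proof.
  destruct hu as [Hup Hum].
  set (F := incoming c g h). set (Kp := outgoing_initial c g h).
  set (Km := outgoing_reflected c g h nu).
  assert (Hh : forall y, continuous h y).
  { intros y. apply (Dn_near_continuous 0). now apply Dn_near_everywhere. }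
  assert (HF : forall y, Dn_near 2 F y) by (intros; now apply incoming_regular).
  assert (HKp : forall y, Dn_near 2 Kp y) by (intros; now apply outgoing_initial_regular).
  assert (HKm : forall y, 0 < y -> Dn_near 2 Km y)
    by (intros; now apply outgoing_reflected_regular).
  assert (CF : forall y, continuous F y) by (intros; now apply (Dn_near_continuous 1)).
  assert (CKp : forall y, continuous Kp y) by (intros; now apply (Dn_near_continuous 1)).
  assert (Ep : forall q, D_plus c q -> u (fst q) (snd q) = wave c F Kp (fst q) (snd q)).
  { intros [x t] Hq. simpl. rewrite Hup by exact Hq. now apply u_plus_wave. }
  assert (Em : forall q, D_minus c q -> u (fst q) (snd q) = wave c F Km (fst q) (snd q)).
  { intros [x t] Hq. simpl. rewrite Hum by exact Hq. now apply u_minus_wave. }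
  assert (Lp : forall x t, D_plus c (x, t) ->
    locally (x, t) (fun q => u (fst q) (snd q) = wave c F Kp (fst q) (snd q))).
  { intros x t Hq. generalize (locally_D_plus _ _ Hq). apply filter_imp. exact Ep. }
  assert (Lm : forall x t, D_minus c (x, t) ->
    locally (x, t) (fun q => u (fst q) (snd q) = wave c F Km (fst q) (snd q))).
  { intros x t Hq. generalize (locally_D_minus _ _ Hq). apply filter_imp. exact Em. }
  split; [split; [|split; [|split]]|split].
  - intros x t [Hq|Hq].
    + apply (wave_equation c F Kp); auto.
    + apply (wave_equation c F Km); auto.
      apply HKm. destruct Hq as [[_ Hq] _]. simpl in Hq. lra.
  - intros x Hx.
    replace (g x) with (wave c F Kp x 0).
    + apply (lim_in_ext _ (wave c F Kp)).
      * generalize (quadrant_near_initial_line c x Hx). apply filter_imp.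
        intros q Hq HQ. symmetry. apply Ep; auto.
      * now apply lim_in_wave_continuous.
    + unfold F, Kp. rewrite <- u_plus_wave by exact Hh. unfold u_plus.
      rewrite Rmult_0_r, Rplus_0_r, Rminus_0_r, RInt_point. unfold zero; simpl. field. lra.
  - intros x Hx.
    assert (C1 : forall f y, Dn_near 2 f y -> continuous (fun z => c * Derive f z) y).
    { intros f y Hf. apply (continuous_scal_r c (Derive f)).
      apply (@ex_derive_continuous R_AbsRing R_NormedModule (Derive f) y).
      exact (Dn_near_at _ _ _ 2 Hf (le_n 2)). }
    (* The time derivative of the wave is again a wave, with these profiles. *)
    set (F' := fun z => c * Derive F z). set (K' := fun z => c * Derive Kp z).
    replace (h x) with (wave c F' K' x 0).
    + apply (lim_in_ext _ (wave c F' K')).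
      * generalize (quadrant_near_initial_line c x Hx). apply filter_imp.
        intros [y t] Hq HQ. simpl. symmetry.
        destruct (wave_derivatives c F Kp u y t (HF _) (HKp _) (Lp _ _ (Hq HQ)) 1) as [[_ E] _];
          [lia|].
        change (Derive_n (fun s => u y s) 1 t = wave c F' K' y t). rewrite E.
        rewrite pow_1. apply Rmult_plus_distr_l.
      * apply lim_in_wave_continuous; apply C1; auto.
    + unfold wave, F', K'.
      replace (x + c * 0) with x by ring. replace (c * 0 - x) with (- x) by ring.
      rewrite <- Rmult_plus_distr_l. apply initial_velocity; auto.
      * lra.
      * exact (Dn_near_at _ _ _ 1 (Dn_near_everywhere _ _ x hg) (le_S _ _ (le_n 1))).
  - intros t Ht.
    assert (Hct : 0 < c * t) by now apply Rmult_lt_0_compat.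
    replace (nu t) with (wave c F Km 0 t).
    + apply (lim_in_ext _ (wave c F Km)).
      * generalize (quadrant_near_boundary_line c t Hct). apply filter_imp.
        intros q Hq HQ. symmetry. apply Em; auto.
      * apply lim_in_wave_continuous; auto.
        apply (Dn_near_continuous 1). apply HKm. lra.
    + unfold wave, Km, outgoing_reflected. fold F.
      replace (0 + c * t) with (c * t - 0) by ring.
      replace ((c * t - 0) / c) with t by (field; lra). ring.
  - intros x _. now apply jump_value.
  - intros Hnu0 x Hx.
    assert (Hline : c * (x / c) = x) by (field; lra).
    assert (Lminus : lim_in (D_minus c) u (x, x / c) (u_minus c g h nu x (x / c))).
    { rewrite u_minus_wave by exact hc. fold F Km.
      apply (lim_in_ext _ (wave c F Km)).
      - apply filter_forall. intros q Hq. symmetry. now apply Em.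
      - apply lim_in_wave; [now apply lim_forward_phase|].
        apply lim_reflected_phase; [exact Hline|].
        replace (c * (x / c) - x) with 0 by lra.
        apply outgoing_reflected_at_right; auto. }
    assert (Lplus : lim_in (D_plus c) u (x, x / c) (u_plus c g h x (x / c))).
    { rewrite u_plus_wave by exact Hh. fold F Kp.
      apply (lim_in_ext _ (wave c F Kp)).
      - apply filter_forall. intros q Hq. symmetry. now apply Ep.
      - now apply lim_in_wave_continuous. }
    split; [exact Lminus|split; [exact Lplus|]].
    rewrite (discontinuous_across_iff _ _ _ _ _ hc Hx Lminus Lplus).
    assert (Hj := jump_value c g h nu x hc). unfold jump in Hj.
    split; intros H H'; apply H; lra.
Qed.
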